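(* Let $W$ be a Coxeter group with finite generating set $S$, and let $P\subset W$ be a Shi part. Then $P$ has a smallest element with respect to $\preceq$; that is, there is $p\in P$ such that $p\preceq p'$ for all $p'\in P$.
   Context: A Coxeter group $W$ is a group generated by a finite set $S$ subject only to the relations $s^2=1$ for $s\in S$ and $(st)^{m_{st}}=1$ for $s\neq t\in S$, where $m_{st}=m_{ts}\in\{2,3,\ldots,\infty\}$, and $m_{st}=\infty$ means that no relation is imposed between $s$ and $t$. Let $X^1$ be the Cayley graph of $W$: the graph with vertex set $X^0=W$ and an edge of length $1$ joining $g$ and $gs$ for each $g\in W$, $s\in S$. Here $X^1$ is considered as a topological (metric) graph. For $g\in W$, $\ell(g)$ is the word length, i.e. the distance in $X^1$ from $g$ to $\mathrm{id}$. $W$ acts on $X^0=W$ by left multiplication, and this induces an action on $X^1$. For $r\in W$ a conjugate of an element of $S$ (a reflection), the wall $\mathcal W_r$ is the fixed point set of $r$ in $X^1$. Each wall $\mathcal W$ separates $X^1$ into two components, called half-spaces. A wall separates two subsets (or points) of $X^1$ if they are contained in distinct half-spaces of that wall. The partial order $\preceq$ on $W$ (the weak order) is defined by: $p\preceq g$ if $p$ lies on a geodesic in $X^1$ from $\mathrm{id}$ to $g$; equivalently, no wall separates $p$ from both $\mathrm{id}$ and $g$. Let $\mathcal E$ be the set of walls $\mathcal W$ such that there is no wall separating $\mathcal W$ from $\mathrm{id}$. The connected components of $X^1\setminus\bigcup\mathcal E$ are the Shi components. For a Shi component $Y$, the set $P=Y\cap X^0$ is the corresponding Shi part. *)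

(* Defs.v *)
From HB Require Import structures.
From mathcomp Require Import all_boot all_order all_algebra finmap.
From mathcomp Require Import all_classical all_reals all_analysis.

Set Implicit Arguments.
Unset Strict Implicit.
Unset Printing Implicit Defensive.

Import Order.TTheory GRing.Theory Num.Theory.
Import numFieldNormedType.Exports.

Local Open Scope classical_set_scope.
Local Open Scope ring_scope.

(* The exponents m_st, with [None] for infinity.  Only the values of [m] at
   distinct elements of [S] matter. *)
Definition coxeter_matrix (W : groupType) (S : {fset W})
    (m : W -> W -> option nat) : Prop :=
  forall s t, s \in S -> t \in S -> s != t ->
    m s t = m t s /\ forall k, m s t = Some k -> (2 <= k)%N.

Definition coxeter_relations (W : groupType) (S : {fset W})
    (m : W -> W -> option nat) (H : groupType) (f : W -> H) : Prop :=
  (forall s, s \in S -> (f s ^+ 2 = 1)%g) /\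
  (forall s t k, s \in S -> t \in S -> s != t -> m s t = Some k ->
     ((f s * f t) ^+ k = 1)%g).

Definition generates (W : groupType) (S : {fset W}) : Prop :=
  forall A : set W, A 1%g -> (forall g h, A g -> A h -> A (g * h)%g) ->
    (forall g, A g -> A (g^-1)%g) -> (forall s, s \in S -> A s) ->
    forall g, A g.

(* "Subject only to the relations": any assignment of the generators in any
   group that satisfies the relations extends to a homomorphism from [W], which
   is unique because [S] generates [W]. *)
Definition coxeter_group (W : groupType) (S : {fset W})
    (m : W -> W -> option nat) : Prop :=
  [/\ coxeter_matrix S m, generates S, coxeter_relations S m (@id W) &
      forall (H : groupType) (f : W -> H), coxeter_relations S m f ->
        exists phi : {multiplicative W -> H}, forall s, s \in S -> phi s = f s].

Definition reflection (W : groupType) (S : {fset W}) (r : W) : Prop :=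
  exists2 s, s \in S & exists g, r = (g * s * g^-1)%g.

(* The simple graph with one edge {g, gs} for all g and s: the pairs (g, s) and
   (gs, s) give the same edge, so that a reflection can fix a midpoint. *)
Definition cayley_adj (W : groupType) (S : {fset W}) : rel W :=
  fun g h => (g^-1 * h)%g \in S.

Definition walk (W : groupType) (S : {fset W}) (g : W) (q : seq W) (h : W)
  : Prop := path (cayley_adj S) g q /\ last g q = h.

Definition geodesic (W : groupType) (S : {fset W}) (g : W) (q : seq W) (h : W)
  : Prop := walk S g q h /\ forall q', walk S g q' h -> (size q <= size q')%N.

Definition weak_le (W : groupType) (S : {fset W}) (p g : W) : Prop :=
  exists2 q, geodesic S 1%g q g & p \in 1%g :: q.

(* The metric graph X^1 in barycentric coordinates: the point at distance [t]
   from [g] on the edge {g, h} is the function (1 - t) [g] + t [h] on [W].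
   On this set of functions (nonnegative, of sum 1, with at most two nonzero
   values) the topology of pointwise convergence is that of the l^1 distance,
   which is also that of the path metric with edges of length 1. *)
Definition vertex (R : realType) (W : groupType) (g : W) : {ptws W -> R} :=
  fun k => (k == g)%:R.

Definition edge_point (R : realType) (W : groupType) (g h : W) (t : R)
  : {ptws W -> R} :=
  fun k => (1 - t) * vertex R g k + t * vertex R h k.

Definition cayley_graph (R : realType) (W : groupType) (S : {fset W})
  : set {ptws W -> R} :=
  [set x | exists g, x = vertex R g] `|`
  [set x | exists g h t, [/\ cayley_adj S g h, 0 <= t <= 1 &
                             x = edge_point g h t]].

(* Maps [vertex R k] to [vertex R (g * k)] and is affine on edges. *)
Definition act (R : realType) (W : groupType) (g : W) (x : {ptws W -> R})
  : {ptws W -> R} :=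
  fun k => x (g^-1 * k)%g.

Definition wall_of (R : realType) (W : groupType) (S : {fset W}) (r : W)
  : set {ptws W -> R} :=
  [set x | cayley_graph S x /\ act r x = x].

Definition is_wall (R : realType) (W : groupType) (S : {fset W})
    (M : set {ptws W -> R}) : Prop :=
  exists2 r, reflection S r & M = wall_of S r.

Definition component_of (T : topologicalType) (A Y : set T) : Prop :=
  exists2 x, A x & Y = connected_component A x.

Definition half_space (R : realType) (W : groupType) (S : {fset W})
    (M H : set {ptws W -> R}) : Prop :=
  component_of (cayley_graph S `\` M) H.

Definition separates (R : realType) (W : groupType) (S : {fset W})
    (M A B : set {ptws W -> R}) : Prop :=
  exists H1 H2, [/\ half_space S M H1, half_space S M H2, H1 <> H2,
                    A `<=` H1 & B `<=` H2].

Definition shi_wall (R : realType) (W : groupType) (S : {fset W})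
    (M : set {ptws W -> R}) : Prop :=
  is_wall S M /\
  ~ exists2 N, is_wall S N & separates S N M [set vertex R 1%g].

Definition shi_component (R : realType) (W : groupType) (S : {fset W})
    (Y : set {ptws W -> R}) : Prop :=
  component_of
    (cayley_graph S `\` \bigcup_(M in [set M | shi_wall S M]) M) Y.

Definition shi_part (R : realType) (W : groupType) (S : {fset W})
    (P : set W) : Prop :=
  exists2 Y : set {ptws W -> R}, shi_component S Y & P = [set g | Y (vertex R g)].

(* Main.v *)
(* A Coxeter group carries a cocycle [side x g], telling whether the wall of the
   reflection [x] separates [1] from [g]: the homomorphism from W to the product
   (W -> bool) x| W that sends each generator s to (indicator of s, s).  Hence a
   geodesic crosses every wall at most once, and the Shi part of a vertex is its
   class under "no Shi wall separates".

   Inside a Shi part, go down along edges.  Any two vertices are joined by a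
   geodesic in the part, so by a diamond argument a vertex of minimal length is
   below all others as soon as two down edges gs, gt can be completed.
   Projecting 1 to the coset g<s, t> gives a vertex m0 below gs and gt, and g
   is antipodal to m0 in a 2k-gon; the point is that if the two walls next to g
   are not Shi walls, then none of the k walls of the polygon is.

   These walls are obtained from the two extreme ones by conjugating with an
   extreme reflection a.  Let the wall of n separate the wall of c from 1; then
   the wall of n or that of a n a separates the wall of a c a from 1, provided a c a
   lies between a and c.  The case where n separates 1 from a rests on
   [obtuse_side]. *)
From HB Require Import structures.
Require Import Defs.
From mathcomp Require Import zify lra.
From mathcomp Require Import all_boot all_order all_algebra finmap.
From mathcomp Require Import all_classical all_reals all_analysis.

Set Implicit Arguments.
Unset Strict Implicit.
Unset Printing Implicit Defensive.

Import Order.TTheory GRing.Theory Num.Theory.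
Import numFieldNormedType.Exports.

Local Open Scope group_scope.

(** * The side cocycle *)

Section TwistedProduct.
Variable W : groupType.

(* The semidirect product (W -> bool) x| W, with W acting by conjugation. *)
Definition twisted : Type := (W * (W -> bool))%type.
HB.instance Definition _ := Choice.on twisted.

Definition twisted_mul (x y : twisted) : twisted :=
  (x.1 * y.1, fun r => x.2 r (+) y.2 (x.1^-1 * r * x.1)).
Definition twisted_one : twisted := (1, fun=> false).
Definition twisted_inv (x : twisted) : twisted :=
  (x.1^-1, fun r => x.2 (x.1 * r * x.1^-1)).

Lemma twisted_mulA : associative twisted_mul.
Proof.
move=> x y z; congr pair; first exact: mulgA.
by apply/funext => r /=; rewrite addbA invgM !mulgA.
Qed.

Lemma twisted_mul1 : left_id twisted_one twisted_mul.
Proof.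
move=> [g f]; congr pair; first exact: mul1g.
by apply/funext => r /=; rewrite invg1 mul1g mulg1.
Qed.

Lemma twisted_mulr1 : right_id twisted_one twisted_mul.
Proof.
move=> [g f]; congr pair; first exact: mulg1.
by apply/funext => r /=; rewrite addbF.
Qed.

Lemma twisted_mulV : left_inverse twisted_one twisted_inv twisted_mul.
Proof.
move=> [g f]; congr pair; first exact: mulVg.
by apply/funext => r /=; rewrite invgK addbb.
Qed.

Lemma twisted_mulrV : right_inverse twisted_one twisted_inv twisted_mul.
Proof.
move=> [g f]; congr pair; first exact: mulgV.
by apply/funext => r /=; rewrite !mulgA mulgV mul1g -mulgA mulgV mulg1 addbb.
Qed.

HB.instance Definition _ := isGroup.Build twisted
  twisted_mulA twisted_mul1 twisted_mulr1 twisted_mulV twisted_mulrV.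
End TwistedProduct.

(* [side x g]: a path from [1] to [g] crosses the wall of [x] an odd number of
   times. *)
Definition side_cocycle (W : groupType) (S : {fset W}) (side : W -> W -> bool) : Prop :=
  (forall x s, s \in S -> side x s = (x == s)) /\
  (forall x g h, side x (g * h) = side x g (+) side (g^-1 * x * g) h).

Lemma expg_twisted (W : groupType) (x : twisted W) n :
  x ^+ n = (x.1 ^+ n,
            fun r => \big[addb/false]_(i < n) x.2 (x.1 ^- i * r * x.1 ^+ i)).
Proof.
elim: n => [|n IHn].
  by rewrite !expg0; congr pair; apply/funext => r; rewrite big_ord0.
rewrite expgSr IHn; congr pair; first by rewrite expgSr.
by apply/funext => r; rewrite big_ord_recr.
Qed.

(** The cocycle is the second component of the extension of [f] to the twisted product. For the
    relation of [s] and [t] this component counts modulo 2 the [j] below [2 * k] with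
    [r = p ^+ j * s]; as the condition has period [k] in [j], the count is even. *)
Lemma coxeter_side_cocycle (W : groupType) (S : {fset W})
    (m : W -> W -> option nat) : coxeter_group S m ->
  exists side, side_cocycle S side.
Proof.
move=> [_ genS [invS relS] univ].
have SS s : s \in S -> s * s = 1 by move=> /invS; rewrite expg2.
have SV s : s \in S -> s^-1 = s by move=> /SS; exact: mulg1_eq.
have conjE (x y z : W) : (x^-1 * y * x == z) = (y == x * z * x^-1).
  by apply/eqP/eqP => [<-|->]; rewrite !mulgA ?(mulgV, mulVg) mul1g -mulgA
    ?(mulgV, mulVg) mulg1.
pose f (s : W) : twisted W := (s, fun r => r == s).
have [|phi phiE] := univ (twisted W) f.
  split=> [s sS|s t k sS tS st mst].
    rewrite expg2; congr pair; first exact: SS.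
    by apply/funext => r /=; rewrite conjE mulgK addbb.
  rewrite expg_twisted; congr pair; first exact: (relS s t k).
  apply/funext => r /=; set p := s * t.
  have pk : p ^+ k = 1 by exact: (relS s t k).
  have sp : s * p^-1 = p * s by rewrite invgM !SV // mulgA.
  have spX i : s * p ^- i = p ^+ i * s.
    elim: i => [|i IHi]; first by rewrite expg0 invg1 mulg1 mul1g.
    by rewrite expgSr invgM mulgA sp -mulgA IHi mulgA -expgS -expgSr.
  pose G j := r == p ^+ j * s.
  have E1 i : (p ^- i * r * p ^+ i == s) = G (2 * i)%N.
    by rewrite conjE -mulgA spX mulgA -expgnDr addnn mul2n.
  have E2 i : (s^-1 * (p ^- i * r * p ^+ i) * s == t) = G (2 * i).+1.
    by rewrite conjE conjE SV // -/p mulgA -(mulgA _ s) spX mulgA -expgSr -expgnDr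
      addSn addnn mul2n.
  have Gk j : G (k + j)%N = G j by rewrite /G expgnDr pk mul1g.
  transitivity (\big[addb/false]_(0 <= j < 2 * k) G j).
    rewrite -(big_mkord xpredT (fun i => (p ^- i * r * p ^+ i == s) (+)
      (s^-1 * (p ^- i * r * p ^+ i) * s == t))).
    under eq_bigr do rewrite E1 E2.
    elim: (k) => [|n IHn]; first by rewrite muln0 !big_geq.
    by rewrite big_nat_recr // IHn mulnS add2n !big_nat_recr //= addbA.
  rewrite mul2n -addnn (big_cat_nat _ (n := k)) ?leq_addr //=.
  rewrite -{2}[k]add0n big_addn addnK.
  by under [X in _ (+) X]eq_bigr do rewrite addnC Gk; exact: addbb.
have phi1 : phi 1 = 1.
  by apply: (mulgI (phi 1)); rewrite mulg1 -gmulfM mulg1.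
have phiV h : phi h^-1 = (phi h)^-1.
  by symmetry; apply: mulg1_eq; rewrite -gmulfM mulgV.
have phiE1 g : (phi g).1 = g.
  suff: [set h | (phi h).1 = h]%classic g by [].
  apply: genS => /=.
  - by rewrite phi1.
  - by move=> g' h' g'E h'E; rewrite gmulfM /= g'E h'E.
  - by move=> h hE; rewrite phiV /= hE.
  - by move=> s /phiE ->.
exists (fun x g => (phi g).2 x); split=> [x s /phiE -> //|x g h].
by rewrite gmulfM /= phiE1.
Qed.

(** * Geodesics and walls *)

Section Chambers.
Variables (W : groupType) (S : {fset W}) (side : W -> W -> bool).
Hypothesis invS : forall s, s \in S -> s * s = 1.
Hypothesis genS : generates S.
Hypothesis sideS : side_cocycle S side.

Lemma invgS s : s \in S -> s^-1 = s.
Proof. by move=> /invS; exact: mulg1_eq. Qed.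

Lemma sideM x g h : side x (g * h) = side x g (+) side (g^-1 * x * g) h.
Proof. by case: sideS => _ ->. Qed.

Lemma side1 x : side x 1 = false.
Proof.
by have := sideM x 1 1; rewrite mulg1 invg1 mul1g mulg1; case: (side x 1).
Qed.

Lemma sideMs x g s : s \in S -> side x (g * s) = side x g (+) (x == g * s * g^-1).
Proof.
move=> sS; rewrite sideM (sideS.1 _ s) //; congr (_ (+) _).
by apply/eqP/eqP => [<-|->]; rewrite ?mulgA ?(mulgV, mulVg) mul1g -mulgA
    ?(mulgV, mulVg) mulg1.
Qed.

Lemma reflection_edge g s : s \in S -> reflection S (g * s * g^-1).
Proof. by move=> sS; exists s => //; exists g. Qed.

Lemma reflection_inv (r : W) : reflection S r -> r^-1 = r.
Proof. by move=> [s sS [g ->]]; rewrite !invgM invgK (invgS sS) mulgA. Qed.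

Lemma reflectionJ (r g : W) : reflection S r -> reflection S (g * r * g^-1).
Proof.
by move=> [s sS [h ->]]; exists s => //; exists (g * h); rewrite invgM !mulgA.
Qed.

Lemma edge_mul (g s : W) : g * s * g^-1 * g = g * s.
Proof. by rewrite mulgVK. Qed.

Lemma edge_mulS g s : s \in S -> g * s * g^-1 * (g * s) = g.
Proof. by move=> sS; rewrite !mulgA mulgVK -mulgA invS // mulg1. Qed.

(** With [r = u * s * u^-1], the crossings along [u] and on the way back cancel, and the middle edge
    contributes one. *)
Lemma side_reflection (r : W) : reflection S r -> side r r.
Proof.
move=> [s sS [u rE]].
have us : u^-1 * r * u = s by rewrite rE !mulgA mulVg mul1g mulgVK.
have : side r (u * u^-1) = false by rewrite mulgV side1.
rewrite sideM us => ru.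
rewrite {2}rE sideM sideMs // {2}rE eqxx invgM mulgA.
rewrite -(mulgA s^-1) -(mulgA s^-1) us mulVg mul1g.
by case: (side r u) (side s u^-1) ru => [] [].
Qed.

Lemma side_conj a n v : reflection S a ->
  side (a * n * a) v = side n a (+) side n (a * v).
Proof. by move=> ra; rewrite sideM reflection_inv // addKb. Qed.

Definition walks (g h : W) (n : nat) := exists2 q, walk S g q h & size q = n.

Lemma walks0 g : walks g g 0.
Proof. by exists [::]. Qed.

Lemma walks1 g s : s \in S -> walks g (g * s) 1.
Proof.
by move=> sS; exists [:: g * s] => //; split=> //=; rewrite /cayley_adj mulKg sS.
Qed.

Lemma walks_cat g h k n p : walks g h n -> walks h k p -> walks g k (n + p).
Proof.
move=> [q [qp qh] <-] [q' [q'p q'k] <-]; exists (q ++ q'); last by rewrite size_cat.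
by split; rewrite ?cat_path ?last_cat qh ?qp ?q'p.
Qed.

Lemma walks_inv g h n : walks g h n ->
  (n = 0 /\ g = h) \/ exists s p, [/\ s \in S, n = p.+1 & walks (g * s) h p].
Proof.
move=> [[|y q] [/= qp qh] <-]; [by left|right].
move: qp => /andP[gy qp]; exists (g^-1 * y), (size q); split=> //.
by exists q => //; rewrite mulVKg.
Qed.

Lemma walks_sym g h n : walks g h n -> walks h g n.
Proof.
elim: n g => [|n IHn] g /walks_inv [[// _ ->]|[s [p [sS // [<-] gsh]]]].
  exact: walks0.
rewrite -addn1; apply: walks_cat (IHn _ gsh) _.
by have := walks1 (g * s) sS; rewrite -mulgA invS // mulg1.
Qed.

Lemma walks_mul u g h n : walks g h n -> walks (u * g) (u * h) n.
Proof.
elim: n g => [|n IHn] g /walks_inv [[// _ ->]|[s [p [sS // [<-] gsh]]]].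
  exact: walks0.
by rewrite -add1n; apply: walks_cat (walks1 _ sS) _; rewrite -mulgA; exact: IHn.
Qed.

Lemma walks_exists g h : exists n, walks g h n.
Proof.
suff [n gh] : exists n, walks 1 (g^-1 * h) n.
  by exists n; have := walks_mul g gh; rewrite mulg1 mulVKg.
move: (g^-1 * h) => {g h}; apply: (@genS [set h | exists n, walks 1 h n]%classic).
- by exists 0; exact: walks0.
- move=> g h [n wg] [p wh]; exists (n + p); apply: walks_cat wg _.
  by have := walks_mul g wh; rewrite mulg1.
- move=> g [n wg]; exists n; have := walks_mul g^-1 wg.
  by rewrite mulg1 mulVg => /walks_sym.
- by move=> s sS; exists 1%N; have := walks1 1 sS; rewrite mul1g.
Qed.

Definition shortest g h n := walks g h n /\ forall p, walks g h p -> n <= p.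

Lemma shortest_exists g h : exists n, shortest g h n.
Proof.
have ex : exists n, `[< walks g h n >].
  by have [n gh] := walks_exists g h; exists n; apply/asboolP.
have [n /asboolP gh nmin] := ex_minnP ex.
by exists n; split=> // p /asboolP; exact: nmin.
Qed.

Lemma crossing_edge x g h n : side x g != side x h -> walks g h n ->
  exists u s n1 n2, [/\ s \in S, x = u * s * u^-1, walks g u n1,
    walks (u * s) h n2 & n = (n1 + n2).+1].
Proof.
elim: n g => [|n IHn] g xgh /walks_inv [[// _ gh]|[s [p [sS // [<-] gsh]]]].
  by rewrite gh eqxx in xgh.
have [xE|xE] := eqVneq x (g * s * g^-1).
  by exists g, s, 0, n; split=> //; exact: walks0.
have [|u [t [n1 [n2 [tS -> gsu uth ->]]]]] := IHn _ _ gsh.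
  by rewrite sideMs // (negbTE xE) addbF.
exists u, t, n1.+1, n2; split=> //; rewrite -add1n.
exact: walks_cat (walks1 _ sS) gsu.
Qed.

(** The exchange condition: [x] folds the far end of the crossed edge onto the near end, so
    reflecting the rest of the walk saves that edge. *)
Lemma walks_reflect x g h n : side x g != side x h -> walks g h n ->
  exists2 p, p < n & walks g (x * h) p.
Proof.
move=> xgh /(crossing_edge xgh) [u [s [n1 [n2 [sS xE gu ush ->]]]]].
exists (n1 + n2) => //; apply: walks_cat gu _.
by have := walks_mul x ush; rewrite {1}xE edge_mulS.
Qed.

(* Reflecting in [x] both halves of a geodesic that leaves a half-space of [x]
   and returns to it shortens the path. *)
Lemma geodesic_side x g p h n1 n2 : reflection S x ->
  walks g p n1 -> walks p h n2 -> (forall n, walks g h n -> n1 + n2 <= n) ->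
  side x g = side x h -> side x p = side x g.
Proof.
move=> rx gp ph gh_min xgh; apply/eqP/negPn/negP => xp.
have [|k1 k1n gk1] := walks_reflect (x := x) _ gp; first by rewrite eq_sym.
have [|k2 k2n hk2] := walks_reflect (x := x) _ (walks_sym ph).
  by rewrite eq_sym -xgh.
have := gh_min _ (walks_cat gk1 (walks_sym hk2)).
by rewrite leqNgt; case/negP; rewrite (leq_trans (n := n1 + k2)) ?ltn_add2r
  ?leq_add2l // ltnW.
Qed.

Lemma geodesic_side_le x p h n1 n2 : reflection S x ->
  walks 1 p n1 -> walks p h n2 -> (forall n, walks 1 h n -> n1 + n2 <= n) ->
  side x p -> side x h.
Proof.
move=> rx gp ph gh_min xp; apply/negPn/negP => /negbTE xh.
by have := geodesic_side rx gp ph gh_min; rewrite xh side1 xp => /(_ erefl).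
Qed.

(* Otherwise a geodesic from [1] to [v] would cross the wall of [a n a] both before
   and after crossing the wall of [a]. *)
Lemma obtuse_side a n v : reflection S a -> reflection S n -> n != a ->
  side n a -> side a v -> side n v = false -> side n (a * v) = false.
Proof.
move=> ra rn na nae av nv; apply/negP => nav.
have [l [wv vmin]] := shortest_exists 1 v.
have [|u [s [n1 [n2 [sS aE wu usv lE]]]]] := crossing_edge (x := a) _ wv.
  by rewrite side1 av.
have uv : walks u v n2.+1.
  by rewrite -add1n; apply: walks_cat (walks1 _ sS) usv.
have umin p : walks 1 v p -> n1 + n2.+1 <= p by rewrite addnS -lE; exact: vmin.
have nu : side n u = false.
  by apply/negP => /(geodesic_side_le rn wu uv umin); rewrite nv.
have rana : reflection S (a * n * a).
  by rewrite -{2}(reflection_inv ra); exact: reflectionJ.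
(* [a * u = u * s] is on the same side of [n] as [u], so [a * n * a] separates [u] from 1, but it
   does not separate [v] from 1. *)
have := geodesic_side_le rana wu uv umin.
rewrite !side_conj // nae nav {1}aE edge_mul sideMs // nu -aE (negbTE na).
by move=> /(_ isT).
Qed.

(* The half-space of [n] that does not contain [1] contains that of [x]; that is,
   the wall of [n] separates the wall of [x] from [1]. *)
Definition nonsmall x := exists n, [/\ reflection S n, n != x &
  forall v, side x v -> side n v].

(** The vertex [v0] serves to show that [n] is neither [a] nor [a * c * a]. *)
Lemma nonsmall_up a c v0 : reflection S a -> nonsmall c ->
  (forall v, side (a * c * a) v -> side a v || side c v) ->
  side c a = false -> side a v0 = false -> side c v0 -> side (a * c * a) v0 = false ->
  nonsmall (a * c * a).
Proof.
move=> ra [n [rn nc cn]] up ca av0 cv0 c'v0.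
have na : n != a by apply: contraFneq av0 => <-; exact: cn.
case nae: (side n a).
  exists n; split=> // [|v c'v]; first by apply: contraFneq c'v0 => <-; exact: cn.
  apply/negPn/negP => /negbTE nv.
  have cv : side c v = false by apply/negP => /cn; rewrite nv.
  have av : side a v by have := up _ c'v; rewrite cv orbF.
  have := obtuse_side ra rn na nae av nv; move: c'v; rewrite side_conj // ca /=.
  by move=> /cn ->.
(* Neither [c] nor [n] separates 1 from [a], so reflecting in [a] carries the inclusion of their
   half-spaces over to the conjugates. *)
exists (a * n * a); split.
- by rewrite -{2}(reflection_inv ra); exact: reflectionJ.
- by rewrite (inj_eq (mulIg _)) (inj_eq (mulgI _)).
- by move=> v; rewrite !side_conj // ca nae => /cn.
Qed.

(** * Residues of rank two *)

(** Paths towards 1 that cross only non-small walls and so stay in a Shi part. *)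
Inductive descends (g : W) : W -> Prop :=
| descends_refl : descends g g
| descends_step s h : s \in S -> side (g * s * g^-1) g ->
    nonsmall (g * s * g^-1) -> descends (g * s) h -> descends g h.

Section Dihedral.
Variables s t : W.
Hypotheses (sS : s \in S) (tS : t \in S).

Inductive dihedral : W -> Prop :=
| dihedral1 : dihedral 1
| dihedral_s w : dihedral w -> dihedral (w * s)
| dihedral_t w : dihedral w -> dihedral (w * t).

Lemma dihedralM w w' : dihedral w -> dihedral w' -> dihedral (w * w').
Proof.
move=> dw; elim => [|w1 _|w1 _]; rewrite ?mulg1 ?mulgA //.
- exact: dihedral_s.
- exact: dihedral_t.
Qed.

Lemma dihedralV w : dihedral w -> dihedral w^-1.
Proof.
have ds : dihedral s by rewrite -[s]mul1g; exact/dihedral_s/dihedral1.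
have dt : dihedral t by rewrite -[t]mul1g; exact/dihedral_t/dihedral1.
elim => [|w1 _ IH|w1 _ IH]; first by rewrite invg1; exact: dihedral1.
- by rewrite invgM (invgS sS); exact: dihedralM.
- by rewrite invgM (invgS tS); exact: dihedralM.
Qed.

(** Take [g * w] nearest to [v] in the coset. A wall [c] of the coset between them would make
    [c * g * w], again in the coset, nearer. *)
Lemma dihedral_projection g v : exists2 w, dihedral w &
  forall c, reflection S c -> dihedral (g^-1 * c * g) ->
    side c v = side c (g * w).
Proof.
have ex : exists n, `[< exists2 w, dihedral w & walks v (g * w) n >].
  have [n gv] := walks_exists v g; exists n; apply/asboolP; exists 1.
    exact: dihedral1.
  by rewrite mulg1.
have [n /asboolP[w dw vgw] nmin] := ex_minnP ex.
exists w => // c rc dc; apply/eqP/negPn/negP => cv.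
have [p pn vcgw] := walks_reflect cv vgw.
have : n <= p; last by rewrite leqNgt pn.
apply: nmin; apply/asboolP; exists (g^-1 * c * g * w); first exact: dihedralM.
by rewrite !mulgA mulgV mul1g -mulgA.
Qed.

End Dihedral.

(** * Alternating words in two generators *)

Definition letter (s t : W) i := if odd i then t else s.

Fixpoint alt (s t : W) n := if n is n'.+1 then alt s t n' * letter s t n' else 1.

Section Alternating.
Variables s t : W.
Hypotheses (sS : s \in S) (tS : t \in S).

Lemma letterS i : letter s t i \in S.
Proof. by rewrite /letter; case: ifP. Qed.

Lemma altK i : alt s t i.+1 * letter s t i = alt s t i.
Proof. by rewrite /= -mulgA invS ?letterS // mulg1. Qed.

Lemma alt_even d : alt s t d.*2 = (s * t) ^+ d.
Proof.
elim: d => [|d IHd]; first by rewrite expg0.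
by rewrite doubleS /= IHd /letter /= odd_double /= -mulgA -expgSr.
Qed.

Lemma altD d i : alt s t (d.*2 + i) = (s * t) ^+ d * alt s t i.
Proof.
elim: i => [|i IHi]; first by rewrite addn0 alt_even mulg1.
by rewrite addnS /= IHi mulgA /letter oddD odd_double.
Qed.

Lemma altSS i : alt s t i.+2 = s * t * alt s t i.
Proof. by rewrite -[i.+2]/(1.*2 + i)%N altD expg1. Qed.

Lemma s_expg d : s * (s * t) ^+ d = (s * t) ^- d * s.
Proof.
elim: d => [|d IHd]; first by rewrite expg0 invg1 mulg1 mul1g.
rewrite {1}expgSr mulgA IHd expgS invgM -2!mulgA; congr (_ * _).
rewrite invgM (invgS sS) (invgS tS) -mulgA invS // mulg1.
by rewrite mulgA invS // mul1g.
Qed.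

Definition dih_refl i := (s * t) ^+ i * s.

Lemma alt_odd i : alt s t i.*2.+1 = dih_refl i.
Proof. by rewrite /= alt_even /letter odd_double. Qed.

Lemma alt_step i : alt s t i.+1 = dih_refl i * alt s t i.
Proof.
elim/ltn_ind: i => -[|[|i]] IHi.
- by rewrite /dih_refl expg0 /= /letter /= !mul1g mulg1.
- by rewrite /dih_refl expg1 /= /letter /= !mul1g -mulgA -mulgA invS // mulg1.
have hs : s * (s * t) = (s * t)^-1 * s by have := s_expg 1; rewrite expg1.
rewrite !altSS IHi // /dih_refl [in RHS]mulgA -[in RHS](mulgA _ s) hs.
by rewrite [in RHS]mulgA expgSr mulgK expgS !mulgA.
Qed.

Lemma alt_even_swap d : alt t s d.*2 = (s * t) ^- d.
Proof.
elim: d => [|d IHd]; first by rewrite expg0 invg1.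
rewrite doubleS /= IHd /letter /= odd_double /= expgS invgM -mulgA; congr (_ * _).
by rewrite invgM (invgS sS) (invgS tS).
Qed.

(* The word of length 2d closes up, so it can be read backwards. *)
Lemma alt_flip d j : (s * t) ^+ d = 1 -> j <= d.*2 ->
  alt s t j = alt t s (d.*2 - j).
Proof.
move=> rd; elim: j => [|j IHj] jd.
  by rewrite subn0 alt_even_swap rd invg1.
have := IHj (ltnW jd); rewrite -subnSK //= => /(congr1 (fun w => w * letter s t j)).
rewrite -mulgA => ->; rewrite /letter oddB // odd_double /=.
by case: (odd j); rewrite /= invS // mulg1.
Qed.


Lemma dihedral_reflE i : dih_refl i = alt s t i * letter s t i * (alt s t i)^-1.
Proof. by rewrite -[_ * letter s t i]/(alt s t i.+1) alt_step mulgK. Qed.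

Lemma dihedral_refl i : dihedral s t (dih_refl i).
Proof.
rewrite -alt_odd; elim: (i.*2.+1) => [|n IHn]; first exact: dihedral1.
by rewrite /= /letter; case: (odd n); [exact: dihedral_t | exact: dihedral_s].
Qed.

(** * The polygon of a finite residue *)

Section Polygon.
Variable m0 : W.

(* The wall between the vertices [m0 * alt s t i] and [m0 * alt s t i.+1]. *)
Definition polygon_wall i := m0 * dih_refl i * m0^-1.

Lemma polygon_wallE i : polygon_wall i =
  m0 * alt s t i * letter s t i * (m0 * alt s t i)^-1.
Proof. by rewrite /polygon_wall dihedral_reflE invgM !mulgA. Qed.

Lemma polygon_wall_reflection i : reflection S (polygon_wall i).
Proof. by rewrite polygon_wallE; exact/reflection_edge/letterS. Qed.

Lemma polygon_wall_down i : polygon_wall i =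
  m0 * alt s t i.+1 * letter s t i * (m0 * alt s t i.+1)^-1.
Proof.
rewrite polygon_wallE /= !mulgA -(mulgA _ (letter s t i) (letter s t i)).
by rewrite invS ?letterS // mulg1 !invgM (invgS (letterS _)) !mulgA.
Qed.

Lemma side_alt x i :
  side x (m0 * alt s t i.+1) = side x (m0 * alt s t i) (+) (x == polygon_wall i).
Proof. by rewrite /= mulgA sideMs ?letterS // -polygon_wallE. Qed.

Lemma side_alt_wall x i : side x m0 = false -> side x (m0 * alt s t i) ->
  exists2 j, j < i & x = polygon_wall j.
Proof.
move=> xm0; elim: i => [|i IHi]; first by rewrite mulg1 xm0.
rewrite side_alt; have [-> _|_] := eqVneq x (polygon_wall i); first by exists i.
by rewrite addbF => /IHi [j ji ->]; exists j => //; exact: ltnW.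
Qed.

Lemma polygon_wall_inj i j : i <= j -> polygon_wall i = polygon_wall j ->
  (s * t) ^+ (j - i) = 1.
Proof.
move=> ij /mulIg /mulgI; rewrite /dih_refl => /mulIg;
  rewrite -[X in _ = _ ^+ X](subnKC ij) expgnDr.
by rewrite -{1}[_ ^+ i]mulg1 => /mulgI ->.
Qed.

Variable k : nat.
Hypothesis k_gt0 : 0 < k.
Hypothesis st_k : (s * t) ^+ k = 1.
Hypothesis k_min : forall d, 0 < d < k -> (s * t) ^+ d <> 1.
Hypothesis side_m0 : forall i, side (polygon_wall i) m0 = false.
Hypothesis m0_projection : forall v, exists2 w, dihedral s t w &
  forall i, side (polygon_wall i) v = side (polygon_wall i) (m0 * w).

Lemma polygon_wall_eq i j : i < k -> j < k ->
  (polygon_wall i == polygon_wall j) = (i == j).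
Proof.
wlog ij : i j / i < j.
  move=> th ik jk; have [ij|ji|->] := ltngtP i j; last by rewrite eqxx.
    by rewrite th // (ltn_eqF ij).
  by rewrite eq_sym th // (ltn_eqF ji).
move=> ik jk; rewrite (ltn_eqF ij); apply/eqP => /(polygon_wall_inj (ltnW ij)).
by apply: k_min; rewrite subn_gt0 ij (leq_ltn_trans (leq_subr _ _)).
Qed.

Lemma polygon_wallD i : polygon_wall (k + i) = polygon_wall i.
Proof. by rewrite /polygon_wall /dih_refl expgnDr st_k mul1g. Qed.

Lemma side_polygon i j : i < k -> j <= k ->
  side (polygon_wall i) (m0 * alt s t j) = (i < j).
Proof.
move=> ik; elim: j => [|j IHj] jk; first by rewrite mulg1 side_m0.
rewrite side_alt IHj ?(ltnW jk) // polygon_wall_eq // ltnS [in RHS]leq_eqVlt.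
by case: ltngtP.
Qed.

(** Step [k + j] crosses wall [j] a second time, so on the way down the walls are left in the order
    in which they were entered. *)
Lemma side_polygonD i j : i < k -> j <= k ->
  side (polygon_wall i) (m0 * alt s t (k + j)) = (j <= i).
Proof.
move=> ik; elim: j => [|j IHj] jk; first by rewrite addn0 side_polygon.
rewrite addnS side_alt IHj ?(ltnW jk) // polygon_wallD polygon_wall_eq //.
by case: ltngtP.
Qed.

Lemma alt_2k : alt s t k.*2 = 1.
Proof. by rewrite alt_even. Qed.

Lemma dihedral_alt w : dihedral s t w -> exists2 i, i <= k.*2 & w = alt s t i.
Proof.
have k2 : 0 < k.*2 by rewrite double_gt0.
suff step i x : x = s \/ x = t -> i <= k.*2 ->
    exists2 j, j <= k.*2 & alt s t i * x = alt s t j.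
  elim => [|w' _ [i ik ->]|w' _ [i ik ->]]; first by exists 0.
  - by apply: step => //; left.
  - by apply: step => //; right.
move=> xst.
(* Vertex 0 is also vertex 2k, which has a predecessor. *)
wlog i_gt0 : i / 0 < i.
  case: i => [|i] th; last exact: th.
  by have := th k.*2 k2 (leqnn _); rewrite alt_2k.
move=> ik; have [xE|xE] := eqVneq x (letter s t i).
  move: ik; rewrite leq_eqVlt => /predU1P[ik|ik]; last first.
    by exists i.+1 => //; rewrite xE.
  exists 1%N; first by [].
  by rewrite xE ik /letter odd_double alt_2k.
exists i.-1; first exact: leq_trans (leq_pred _) ik.
have -> : x = letter s t i.-1; last by rewrite -{1}(prednK i_gt0) altK.
case: i i_gt0 {ik} xE => // i _; rewrite /letter /=.
by case: xst => ->; case: (odd i); rewrite //= eqxx.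
Qed.

(** Projection replaces [v] by a vertex of the polygon. The walls between it and [m0] form an
    initial segment of the indices on the way up and a final one on the way down. *)
Lemma polygon_wall_between v i j l : i <= j -> j <= l -> l < k ->
  side (polygon_wall j) v -> side (polygon_wall i) v || side (polygon_wall l) v.
Proof.
move=> ij jl lk; have [w /dihedral_alt [p pk ->] vE] := m0_projection v.
have jk := leq_ltn_trans jl lk; have ik := leq_ltn_trans ij jk.
rewrite !vE; have [pk'|/ltnW kp] := leqP p k.
  by rewrite !side_polygon // => jp; rewrite (leq_ltn_trans ij jp).
rewrite -(subnKC kp) in pk *; rewrite -addnn leq_add2l in pk.
by rewrite !side_polygonD // => pj; rewrite (leq_trans pj jl) orbT.
Qed.

Lemma conj_wall_mul x y : m0 * x * m0^-1 * (m0 * y * m0^-1) * (m0 * x * m0^-1) =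
  m0 * (x * y * x) * m0^-1.
Proof. by rewrite !mulgA !mulgVK. Qed.

(** Conjugation by wall [j] sends wall [i] to wall [2j - i], with indices modulo [k]; here [j = 0],
    and next [j = k - 1]. *)
Lemma polygon_wall_conj0 i : i <= k ->
  polygon_wall 0 * polygon_wall (k - i) * polygon_wall 0 = polygon_wall i.
Proof.
move=> ik; rewrite conj_wall_mul; congr (_ * _ * _).
rewrite /dih_refl expg0 !mul1g -!mulgA invS // mulg1 s_expg; congr (_ * _).
by rewrite expgnFr // st_k div1g invgK.
Qed.

Lemma polygon_wall_conj_last i : i.+1 < k ->
  polygon_wall k.-1 * polygon_wall i * polygon_wall k.-1 = polygon_wall (k - i.+2).
Proof.
move=> ik; rewrite conj_wall_mul; congr (_ * _ * _).
have rk1 : (s * t) ^+ k.-1 = (s * t)^-1.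
  by apply: (mulgI (s * t)); rewrite -expgS prednK // st_k mulgV.
have hs : s * ((s * t)^-1 * s) = s * t.
  by rewrite invgM (invgS sS) (invgS tS) -mulgA invS // mulg1.
rewrite /dih_refl rk1 expgnFr // st_k mul1g.
transitivity ((s * t)^-1 * (s * ((s * t) ^+ i * (s * ((s * t)^-1 * s))))).
  by rewrite !mulgA.
by rewrite hs -expgSr s_expg mulgA [in RHS]expgSr [in RHS]invgM.
Qed.

(** As a vertex, [polygon_wall i] need not lie in the polygon, but [polygon_wall i * m0] does. Both
    are on the same side of [c], because wall [l] does not separate [m0] from 1. *)
Lemma side_polygon_wall c i l : polygon_wall i * c * polygon_wall i = polygon_wall l ->
  side c (polygon_wall i) = side c (m0 * alt s t i.*2.+1).
Proof.
move=> cE; have -> : m0 * alt s t i.*2.+1 = polygon_wall i * m0.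
  by rewrite alt_odd mulgVK.
by rewrite sideM (reflection_inv (polygon_wall_reflection i)) cE side_m0 addbF.
Qed.

(** Induction from both ends inwards: wall 0 reflects wall [k - (i + 1)] to wall [i + 1], and wall
    [k - 1] reflects wall [i] to wall [k - (i + 2)]. *)
Lemma polygon_wall_nonsmall j : nonsmall (polygon_wall 0) ->
  nonsmall (polygon_wall k.-1) -> j < k -> nonsmall (polygon_wall j).
Proof.
move=> ns0 nsk.
have both i : i.*2 < k ->
    nonsmall (polygon_wall i) /\ nonsmall (polygon_wall (k.-1 - i)).
  elim: i => [|i IHi] ik; first by rewrite subn0.
  have {IHi}[|nsi nski] := IHi; first by apply: ltn_trans ik; rewrite ltn_double.
  have i2k : i.*2.+2 < k by rewrite -doubleS.
  have wr := polygon_wall_reflection.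
  split.
  - have kE : k.-1 - i = k - i.+1 by lia.
    have conjE : polygon_wall 0 * polygon_wall (k.-1 - i) * polygon_wall 0 =
      polygon_wall i.+1 by rewrite kE polygon_wall_conj0 //; lia.
    (* On the way down, the last vertex before wall [k - 1 - i] is crossed back. *)
    rewrite -conjE; apply: (nonsmall_up (v0 := m0 * alt s t (k + (k.-1 - i)))) => //.
    + by rewrite conjE => v; apply: polygon_wall_between; lia.
    + by rewrite (side_polygon_wall conjE) side_polygon; lia.
    + by rewrite side_polygonD; lia.
    + by rewrite side_polygonD; lia.
    + by rewrite conjE side_polygonD; lia.
  - have kE : k.-1 - i.+1 = k - i.+2 by lia.
    have conjE : polygon_wall k.-1 * polygon_wall i * polygon_wall k.-1 =
      polygon_wall (k.-1 - i.+1) by rewrite kE polygon_wall_conj_last //; lia.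
    (* On the way up, the first vertex beyond wall [i]. *)
    rewrite -conjE; apply: (nonsmall_up (v0 := m0 * alt s t i.+1)) => //.
    + rewrite conjE => v; rewrite orbC; apply: polygon_wall_between; lia.
    + rewrite (side_polygon_wall conjE).
      have -> : k.-1.*2.+1 = k + k.-1 by lia.
      by rewrite side_polygonD; lia.
    + by rewrite side_polygon; lia.
    + by rewrite side_polygon; lia.
    + by rewrite conjE side_polygon; lia.
move=> jk; have [jk2|jk2] := ltnP j.*2 k; first by case: (both j jk2).
have [|_] := both (k.-1 - j); first by lia.
by have -> : k.-1 - (k.-1 - j) = j by lia.
Qed.

Hypothesis nonsmall0 : nonsmall (polygon_wall 0).
Hypothesis nonsmall_last : nonsmall (polygon_wall k.-1).

Lemma descends_alt j : j <= k -> descends (m0 * alt s t j) m0.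
Proof.
elim: j => [|j IHj] jk; first by rewrite mulg1; exact: descends_refl.
apply: (descends_step (letterS j)); rewrite -?polygon_wall_down.
- by rewrite side_polygon.
- exact: polygon_wall_nonsmall.
- by rewrite -mulgA altK; exact: IHj (ltnW jk).
Qed.

Lemma descends_altD j : j <= k -> descends (m0 * alt s t (k + j)) m0.
Proof.
move=> jk; rewrite -(subKn jk); elim: (k - j) (leq_subr j k) => [|i IHi] ik.
  by rewrite subn0 addnn alt_2k mulg1; exact: descends_refl.
apply: (descends_step (letterS (k + (k - i.+1)))); rewrite -?polygon_wallE.
- by rewrite polygon_wallD side_polygonD ?leqnn //; lia.
- by rewrite polygon_wallD; apply: polygon_wall_nonsmall => //; lia.
- rewrite -mulgA -[_ * letter _ _ _]/(alt s t (k + (k - i.+1)).+1).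
  by rewrite -addnS subnSK // ; apply: IHi; exact: ltnW.
Qed.

End Polygon.
End Alternating.

(** * Confluence in a residue of rank two *)

Lemma dihedral_sym s t w : dihedral s t w -> dihedral t s w.
Proof.
by elim => [|w' _|w' _]; [exact: dihedral1 | exact: dihedral_t | exact: dihedral_s].
Qed.

Definition dihedral_word s t w i := (w == alt s t i) || (w == alt t s i).

Lemma dihedral_wordP s t w : s \in S -> t \in S -> dihedral s t w ->
  exists i, dihedral_word s t w i.
Proof.
move=> sS tS.
have step s' t' i x : s' \in S -> t' \in S -> x = s' \/ x = t' ->
    exists j, dihedral_word s' t' (alt s' t' i * x) j.
  move=> s'S t'S xE; have [->|xi] := eqVneq x (letter s' t' i).
    by exists i.+1; rewrite /dihedral_word eqxx.
  case: i xi => [|i] xi.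
    exists 1%N; case: xE xi => ->; rewrite /letter /= ?eqxx // => _.
    by rewrite /dihedral_word /= /letter /= !mul1g eqxx orbT.
  exists i; have -> : x = letter s' t' i; last by rewrite altK // /dihedral_word eqxx.
  by move: xi; rewrite /letter /=; case: xE => ->; case: (odd i); rewrite //= eqxx.
elim => [|w' _ [i /orP[]/eqP ->]|w' _ [i /orP[]/eqP ->]].
- by exists 0; rewrite /dihedral_word eqxx.
- by apply: step => //; left.
- have [|j] := step t s i s tS sS; first by right.
  by exists j; rewrite /dihedral_word orbC.
- by apply: step => //; right.
- have [|j] := step t s i t tS sS; first by left.
  by exists j; rewrite /dihedral_word orbC.
Qed.

(** The letter that would continue the word of [g] also leads down, so wall [k] is an earlier wall;
    by minimality [k] is then the order of [s * t]. The two neighbours of [g] descend along the two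
    sides of the polygon. *)
Lemma polygon_confluence s t m0 g k : s \in S -> t \in S -> g = m0 * alt s t k ->
  (forall j, dihedral_word s t (m0^-1 * g) j -> k <= j) ->
  (forall c, reflection S c -> dihedral s t (m0^-1 * c * m0) -> side c m0 = false) ->
  (forall x, x \in [:: s; t] -> side (g * x * g^-1) g /\ nonsmall (g * x * g^-1)) ->
  descends (g * s) m0 /\ descends (g * t) m0.
Proof.
move=> sS tS gE kmin m0_side g_desc.
have wall_dihedral i : dihedral s t (m0^-1 * polygon_wall s t m0 i * m0).
  by rewrite /polygon_wall !mulgA mulVg mul1g mulgVK; exact: dihedral_refl.
have wr i := polygon_wall_reflection sS tS m0 i.
have side_m0 i : side (polygon_wall s t m0 i) m0 = false by exact: m0_side.
have proj v : exists2 w, dihedral s t w & forall i,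
    side (polygon_wall s t m0 i) v = side (polygon_wall s t m0 i) (m0 * w).
  have [w dw wE] := dihedral_projection s t m0 v.
  by exists w => // i; exact: wE.
have letter_in i : letter s t i \in [:: s; t].
  by rewrite /letter !inE; case: (odd i); rewrite eqxx ?orbT.
(* A smaller order would shorten the word of [m0^-1 * g], by cutting off a full turn if [2 * d <= k]
   and by going round the other way otherwise. *)
have k_min d : 0 < d < k -> (s * t) ^+ d <> 1.
  move=> /andP[d0 dk] rd; have [d2k|d2k] := leqP d.*2 k.
    have : k <= k - d.*2; last by lia.
    by apply: kmin; rewrite gE mulKg -{1}(subnKC d2k) altD rd mul1g
      /dihedral_word eqxx.
  have : k <= d.*2 - k; last by lia.
  by apply: kmin; rewrite gE mulKg (alt_flip sS tS rd (ltnW d2k)) /dihedral_word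
    eqxx orbT.
have [gk nk] := g_desc _ (letter_in k).
have [gk1 nk1] := g_desc _ (letter_in k.-1).
have [j jk wkj] : exists2 j, j < k & polygon_wall s t m0 k = polygon_wall s t m0 j.
  by apply: side_alt_wall => //; rewrite polygon_wallE // -gE.
have k0 : 0 < k by exact: leq_ltn_trans jk.
have rk : (s * t) ^+ k = 1.
  have rkj := polygon_wall_inj (ltnW jk) (esym wkj).
  have [j0|j0] := posnP j; first by rewrite j0 subn0 in rkj.
  by case: (k_min (k - j)) => //; lia.
have ns0 : nonsmall (polygon_wall s t m0 0).
  by rewrite -(polygon_wallD _ rk) addn0 polygon_wallE // -gE.
have ns_last : nonsmall (polygon_wall s t m0 k.-1).
  by rewrite polygon_wall_down // prednK // -gE.
have := descends_alt sS tS k0 rk k_min side_m0 proj ns0 ns_last (leq_pred k).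
rewrite -(altK sS tS) prednK // mulgA -gE => down1.
have := descends_altD sS tS k0 rk k_min side_m0 proj ns0 ns_last k0.
rewrite addn1 /= mulgA -gE => down2.
move: down1 down2; rewrite -{2}(prednK k0) /letter /=.
by case: (odd k.-1) => /=; split.
Qed.

(* The projection of [1] to the residue [g <s, t>] is a common lower bound. *)
Lemma residue_confluence g s t : s \in S -> t \in S ->
  (forall x, x \in [:: s; t] -> side (g * x * g^-1) g /\ nonsmall (g * x * g^-1)) ->
  exists2 m0, descends (g * s) m0 & descends (g * t) m0.
Proof.
move=> sS tS g_desc.
have [w dw wE] := dihedral_projection s t g 1.
set m0 := g * w in wE.
have m0_side c : reflection S c -> dihedral s t (m0^-1 * c * m0) -> side c m0 = false.
  move=> rc dc; rewrite -wE ?side1 //.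
  have -> : g^-1 * c * g = w * (m0^-1 * c * m0) * w^-1.
    by rewrite /m0 invgM !mulgA mulgV mul1g mulgK.
  by do 2?[apply: dihedralM => //]; exact: dihedralV.
have : exists i, dihedral_word s t (m0^-1 * g) i.
  apply: dihedral_wordP => //.
  by rewrite /m0 invgM mulgVK; exact: dihedralV.
move=> /ex_minnP[k kE kmin].
have [/eqP kE'|/eqP kE'] := orP kE; exists m0.
all: have gE := congr1 (fun w => m0 * w) kE'; rewrite mulVKg in gE.
- by have [] := polygon_confluence sS tS gE kmin m0_side g_desc.
- by have [] := polygon_confluence sS tS gE kmin m0_side g_desc.
all: have [|c rc dc|x xts|//] := polygon_confluence tS sS gE.
all: by [move=> j; rewrite /dihedral_word orbC; exact: kmin
  | apply: m0_side => //; exact: dihedral_sym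
  | apply: g_desc; move: xts; rewrite !inE orbC].
Qed.

Lemma walks_down g s n : s \in S -> side (g * s * g^-1) g -> walks 1 g n ->
  exists2 p, p < n & walks 1 (g * s) p.
Proof.
move=> sS gs w1g; rewrite -edge_mul; apply: walks_reflect w1g.
by rewrite side1 gs.
Qed.

Lemma descends_inv g h : descends g h -> g = h \/ exists t, [/\ t \in S,
  side (g * t * g^-1) g, nonsmall (g * t * g^-1) & descends (g * t) h].
Proof. by case=> [|t k tS gt nt gtk]; [left | right; exists t]. Qed.

Lemma descends_trans g h k : descends g h -> descends h k -> descends g k.
Proof.
elim => [//|{}g s {}h sS gs ns _ IH] hk.
exact: descends_step sS gs ns (IH hk).
Qed.

Lemma descends_weak_le g h : descends g h -> weak_le S h g.
Proof.
elim => [{}g|{}g s {}h sS gs ns _ [q [[qp ql] qmin] hq]].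
  have [n [[q wq qn] qmin]] := shortest_exists 1 g.
  exists q; last by case: wq => _ <-; exact: mem_last.
  by split=> // q' wq'; rewrite qn; apply: qmin; exists q'.
exists (rcons q g); last by rewrite -rcons_cons mem_rcons inE hq orbT.
split; first split; rewrite ?last_rcons //.
  by rewrite rcons_path qp ql /cayley_adj invgM mulgVK (invgS sS).
move=> q' wq'; rewrite size_rcons.
have [|p pq [q2 wq2 q2p]] := walks_down sS gs (n := size q'); first by exists q'.
by apply: leq_ltn_trans pq; rewrite -q2p; exact: qmin.
Qed.

(** * The smallest element *)

Section SmallestElement.
Variable P : W -> Prop.
(** Together these make [P] a class under the relation that no small wall separates; the topology
    enters only through them. *)
Hypothesis P_sep : forall g h r, P g -> P h -> reflection S r ->
  side r g != side r h -> nonsmall r.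
Hypothesis P_step : forall g s, P g -> s \in S -> nonsmall (g * s * g^-1) -> P (g * s).

(** Every edge of a geodesic crosses a wall that separates its ends, so a geodesic between elements
    of [P] stays in [P]. *)
Lemma convex_ind (Q : W -> Prop) g h : P g -> P h -> Q g ->
  (forall u s, s \in S -> P u -> P (u * s) -> Q u -> Q (u * s)) -> Q h.
Proof.
move=> Pg Ph Qg Qstep; have [n [gh ghmin]] := shortest_exists g h.
elim: n g Pg Qg gh ghmin => [|n IHn] g Pg Qg /walks_inv
  [[// _ <- //]|[s [p [sS // [<-] gsh]]] ghmin].
have Pgs : P (g * s).
  apply: P_step => //; apply: (P_sep Pg Ph); first exact: reflection_edge.
  apply/eqP => gh.
  have := geodesic_side (reflection_edge _ sS) (walks1 g sS) gsh ghmin gh.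
  by rewrite sideMs // eqxx; case: (side _ g).
apply: (IHn (g * s)) => // [|q gsq]; first exact: Qstep.
by rewrite -ltnS -[q.+1]add1n; apply/ghmin/(walks_cat (walks1 g sS) gsq).
Qed.

Lemma smallest_element : (exists g, P g) ->
  exists2 p, P p & forall g, P g -> weak_le S p g.
Proof.
move=> [g0 Pg0].
have ex : exists n, `[< exists2 g, P g & walks 1 g n >].
  by have [n g0n] := walks_exists 1 g0; exists n; apply/asboolP; exists g0.
have [n0 /asboolP[p Pp wp] n0min] := ex_minnP ex.
have p_bottom s : s \in S -> side (p * s * p^-1) p -> ~ nonsmall (p * s * p^-1).
  move=> sS ps ns; have [n nn0 wps] := walks_down sS ps wp.
  have : n0 <= n; last by rewrite leqNgt nn0.
  by apply: n0min; apply/asboolP; exists (p * s) => //; exact: P_step.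
(* As in Newman's lemma, by induction on the length of a walk from 1: a non-small step down
   preserves the property of descending to [p]. *)
have down n g s : walks 1 g n -> P g -> s \in S -> side (g * s * g^-1) g ->
    nonsmall (g * s * g^-1) -> descends g p -> descends (g * s) p.
  elim/ltn_ind: n g s => n IHn g s wg Pg sS gs ns gp.
  have along u h : descends u h -> P u -> (exists2 k, k < n & walks 1 u k) ->
      descends u p -> descends h p.
    elim => // {}u s' {}h s'S us' ns' _ IH Pu [k kn wu] up.
    have [k' k'k wus'] := walks_down s'S us' wu.
    apply: IH; [exact: P_step| |exact: IHn wu _ _ _ _ _].
    by exists k' => //; exact: ltn_trans kn.
  have [gp'|[t [tS gt nt gtp]]] := descends_inv gp.
    by rewrite gp' in gs ns; case: (p_bottom s).
  (* The given path to [p] starts with [t]. By [along] the property passes from [g * t] to [m0], and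
     [g * s] descends to [m0]. *)
  have [|m0 gsm gtm] := residue_confluence (g := g) sS tS.
    by move=> x; rewrite !inE => /orP[]/eqP->.
  apply: descends_trans gsm _; apply: along gtm _ _ gtp; first exact: P_step.
  exact: walks_down wg.
exists p => // g Pg; apply: descends_weak_le.
apply: (convex_ind (Q := descends^~ p) Pp Pg); first exact: descends_refl.
(* Walking from [p] to [g] inside [P], a step down is handled by [down], and a step up prepends one
   edge to the descending path. *)
move=> u s sS Pu Pus up; have [n wu] := walks_exists 1 u.
have ns : nonsmall (u * s * u^-1).
  apply: (P_sep Pu Pus); first exact: reflection_edge.
  by rewrite sideMs // eqxx; case: (side _ u).
case us : (side (u * s * u^-1) u); first exact: down wu Pu sS us ns up.
have wallE : u * s * s * (u * s)^-1 = u * s * u^-1.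
  by rewrite invgM (invgS sS) !mulgA -(mulgA u) invS // mulg1.
apply: (descends_step sS); rewrite ?wallE //; last by rewrite -mulgA invS // mulg1.
by rewrite sideMs // us eqxx.
Qed.
End SmallestElement.
End Chambers.

Local Close Scope group_scope.
Local Open Scope classical_set_scope.
Local Open Scope ring_scope.

(** * Walls and components in the metric graph *)

Section Points.
Variables (R : realType) (W : groupType).

Lemma edge_pointE (p q k : W) (t : R) :
  edge_point p q t k = (1 - t) * (k == p)%:R + t * (k == q)%:R.
Proof. by []. Qed.

Lemma edge_point0 (p q : W) : edge_point p q 0 = vertex R p.
Proof. by apply/funext => k; rewrite edge_pointE subr0 mul1r mul0r addr0. Qed.

Lemma edge_point1 (p q : W) : edge_point p q 1 = vertex R q.
Proof. by apply/funext => k; rewrite edge_pointE subrr mul1r mul0r add0r. Qed.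

Lemma act_edge_point (g p q : W) (t : R) :
  act g (edge_point p q t) = edge_point (g * p)%g (g * q)%g t.
Proof.
apply/funext => k; rewrite /act !edge_pointE.
by rewrite -2!(inj_eq (mulgI g) (g^-1 * k)%g) mulVKg.
Qed.

Lemma continuous_coordinate (k : W) : continuous (fun x : {ptws W -> R} => x k).
Proof. exact: proj_continuous. Qed.

Lemma continuous_edge_point (p q : W) :
  continuous (edge_point p q : R -> {ptws W -> R}).
Proof.
move=> t; apply/cvg_sup => k.
apply: (@continuous_comp_initial _ R R (fun x : W -> R => x k)) => u.
apply: cvgD; apply: cvgMl; last exact: cvg_id.
by apply: cvgB; [exact: cvg_cst | exact: cvg_id].
Qed.

Lemma connected_edge_segment (A : set {ptws W -> R}) (p q : W) (a b : R) :
  a <= b -> (forall t, a <= t <= b -> A (edge_point p q t)) ->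
  connected_component A (edge_point p q a) (edge_point p q b).
Proof.
move=> ab segA; apply: (@connected_component_max _ _ (edge_point p q @` `[a, b])).
- by exists a => //=; rewrite in_itv /= lexx.
- by move=> _ [t /= tab <-]; apply: segA; rewrite in_itv in tab.
- apply: connected_continuous_connected; first exact: segment_connected.
  exact/continuous_subspaceT/continuous_edge_point.
- by exists b => //=; rewrite in_itv /= lexx andbT.
Qed.

End Points.

Section Walls.
Variables (R : realType) (W : groupType) (S : {fset W}) (side : W -> W -> bool).
Hypothesis invS : forall s, s \in S -> (s * s = 1)%g.
Hypothesis genS : generates S.
Hypothesis sideS : side_cocycle S side.

Lemma generator_neq (g s : W) : s \in S -> (g * s)%g != g.
Proof.
move=> sS; apply/eqP => /(canRL (mulKg _)); rewrite mulVg => s1.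
have := sideS.1 s s sS; rewrite eqxx {2}s1.
by rewrite (side1 sideS).
Qed.

Lemma reflection_neq (r g : W) : reflection S r -> (r * g)%g != g.
Proof.
move=> rr; apply/eqP => /(canRL (mulgK _)); rewrite mulgV => r1.
by have := side_reflection sideS rr; rewrite {2}r1 (side1 sideS).
Qed.

Lemma cayley_vertex (g : W) : cayley_graph S (vertex R g).
Proof. by left; exists g. Qed.

Lemma cayley_edge_point (g s : W) (t : R) : s \in S -> 0 <= t <= 1 ->
  cayley_graph S (edge_point g (g * s)%g t).
Proof.
by move=> sS t01; right; exists g, (g * s)%g, t; rewrite /cayley_adj mulKg.
Qed.

Lemma cayley_graphP (x : {ptws W -> R}) : cayley_graph S x ->
  (exists g, x = vertex R g) \/
  (exists g s t, [/\ s \in S, 0 <= t <= 1 & x = edge_point g (g * s)%g t]).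
Proof.
case=> [[g ->]|[g [h [t [gh t01 ->]]]]]; first by left; exists g.
by right; exists g, (g^-1 * h)%g, t; rewrite mulVKg.
Qed.

(** A fixed point has equal coordinates at [k] and [r * k]. If [r * p] were not [q], both weights
    [1 - t] and [t] would vanish. *)
Lemma edge_point_fixed (r p q : W) (t : R) : p != q -> reflection S r ->
  act r (edge_point p q t) = edge_point p q t -> t = 2^-1 /\ (r * p = q)%g.
Proof.
move=> pq rr fx.
have fxk k : edge_point p q t (r * k)%g = edge_point p q t k.
  by rewrite -{1}fx /act mulKg.
have [pp qp] := (reflection_neq p rr, reflection_neq q rr).
have := fxk p; rewrite !edge_pointE eqxx (negbTE pp) (negbTE pq).
have [rpq|rpq] := eqVneq (r * p)%g q; first by move=> /= ?; split=> //; lra.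
move=> /= t1; have := fxk q; rewrite !edge_pointE eqxx (negbTE qp).
rewrite [q == p]eq_sym (negbTE pq) => t2; exfalso; move: t2.
by case: ((r * q)%g == p) => /=; lra.
Qed.

Lemma vertex_fixed (r g : W) : reflection S r -> act r (vertex R g) <> vertex R g.
Proof.
move=> rr /(congr1 (fun x => x (r * g)%g)); rewrite /act /vertex mulKg eqxx.
by rewrite (negbTE (reflection_neq g rr)) => /eqP; rewrite oner_eq0.
Qed.

Lemma wall_edge_point (r g s : W) (t : R) : reflection S r -> s \in S ->
  0 <= t <= 1 ->
  wall_of S r (edge_point g (g * s)%g t) <-> t = 2^-1 /\ r = (g * s * g^-1)%g.
Proof.
move=> rr sS t01; split=> [[_]|[-> ->]].
  move=> /edge_point_fixed [||-> <-] //; first by rewrite eq_sym generator_neq.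
  by rewrite mulgK.
split; first by apply: cayley_edge_point => //; lra.
rewrite act_edge_point edge_mul (edge_mulS invS) //.
by apply/funext => k; rewrite !edge_pointE addrC; congr (_ * _ + _ * _); lra.
Qed.

(** One form for both uses: [eq r] leaves the half-spaces of one wall, and the Shi walls leave the
    Shi components. *)
Definition graph_minus (E : W -> Prop) : set {ptws W -> R} :=
  [set x | cayley_graph S x /\ forall r, reflection S r -> E r -> ~ wall_of S r x].

Lemma graph_minus_vertex (E : W -> Prop) g : graph_minus E (vertex R g).
Proof.
by split=> [|r rr _ [_]]; [exact: cayley_vertex | exact: vertex_fixed].
Qed.

Lemma graph_minus_edge (E : W -> Prop) (g s : W) (t : R) :
  s \in S -> 0 <= t <= 1 -> ~ (t = 2^-1 /\ E (g * s * g^-1)%g) ->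
  graph_minus E (edge_point g (g * s)%g t).
Proof.
move=> sS t01 tE; split=> [|r rr Er]; first exact: cayley_edge_point.
by move=> /wall_edge_point[] // t2 rE; apply: tE; rewrite -rE.
Qed.

Lemma graph_minus_near (E : W -> Prop) x : graph_minus E x ->
  exists g, connected_component (graph_minus E) x (vertex R g).
Proof.
move=> Ex; have [/cayley_graphP[[g xE]|[g [s [t [sS t01 xE]]]]] xwall] := Ex.
  by exists g; rewrite xE; apply: connected_component_refl; exact: graph_minus_vertex.
have tE : ~ (t = 2^-1 /\ E (g * s * g^-1)%g).
  move=> [t2 Er]; apply: (xwall _ (reflection_edge g sS) Er).
  by rewrite xE; apply/wall_edge_point => //; exact: reflection_edge.
have [t2|t2] := leP t 2^-1.
  exists g; rewrite xE -(edge_point0 R g (g * s)%g); apply: connected_component_sym.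
  apply: connected_edge_segment => [|u u0t]; first by lra.
  apply: graph_minus_edge => [//||[u2 Er]]; first by lra.
  by apply: tE; split=> //; lra.
exists (g * s)%g; rewrite xE -(edge_point1 R g (g * s)%g).
apply: connected_edge_segment => [|u ut1]; first by lra.
by apply: graph_minus_edge => [//||[u2 Er]]; lra.
Qed.

Lemma graph_minus_adj (E : W -> Prop) (g s : W) (a b : R) : s \in S ->
  ~ E (g * s * g^-1)%g -> 0 <= a -> a <= b -> b <= 1 ->
  connected_component (graph_minus E) (edge_point g (g * s)%g a)
    (edge_point g (g * s)%g b).
Proof.
move=> sS nE a0 ab b1; apply: connected_edge_segment => // t tab.
by apply: graph_minus_edge => [//||[_ //]]; lra.
Qed.

(** A geodesic between the vertices stays on their side and never crosses the wall. *)
Lemma graph_minus_same_side (r g h : W) : reflection S r -> side r g = side r h ->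
  connected_component (graph_minus (eq r)) (vertex R g) (vertex R h).
Proof.
move=> rr; have [n [gh ghmin]] := shortest_exists invS genS g h.
elim: n g gh ghmin => [|n IHn] g /walks_inv [[// _ <-]|[s [p [sS // [<-] gsh]]]]
  ghmin rgh.
  by apply: connected_component_refl; exact: graph_minus_vertex.
have rgs := geodesic_side invS sideS rr (walks1 g sS) gsh ghmin rgh.
have rE : r <> (g * s * g^-1)%g.
  by move=> rE; move: rgs; rewrite (sideMs sideS) // -rE eqxx; case: (side r g).
apply: (connected_component_trans (y := vertex R (g * s)%g)).
  rewrite -(edge_point0 R g (g * s)%g) -(edge_point1 R g (g * s)%g).
  by apply: graph_minus_adj => //; lra.
apply: IHn => // [q gsq|]; last by rewrite rgs.
by rewrite -ltnS -[q.+1]add1n; apply/ghmin/(walks_cat (walks1 g sS) gsq).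
Qed.

(** * The two sides of a wall as open sets *)

Definition pair_weight (g h : W) (x : {ptws W -> R}) : R :=
  if g == h then x g else x g + x h.

(* On the Cayley graph: the open 1/2-neighbourhood of the vertices and edges on
   side [b] of [r]. *)
Definition open_side (r : W) (b : bool) : set {ptws W -> R} :=
  \bigcup_(gh in [set gh : W * W | side r gh.1 = b /\ side r gh.2 = b])
    [set x | 2^-1 < pair_weight gh.1 gh.2 x].

Lemma open_open_side r b : open (open_side r b).
Proof.
apply: bigcup_open => -[g h] _ /=.
apply: (@open_comp _ _ (pair_weight g h) [set y | 2^-1 < y]); last exact: open_gt.
move=> x _; rewrite /pair_weight; case: (g == h); first exact: continuous_coordinate.
by apply: continuousD; exact: continuous_coordinate.
Qed.

Lemma pair_weight_edge_point (g h p q : W) (t : R) b r : 0 <= t <= 1 ->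
  side r g = b -> side r h = b ->
  pair_weight g h (edge_point p q t) <=
    (1 - t) * (side r p == b)%:R + t * (side r q == b)%:R.
Proof.
move=> t01 gb hb; have k_le k : (side r k == b)%:R >=
    (if g == h then (g == k)%:R else (g == k)%:R + (h == k)%:R) :> R.
  have [_|gh] := eqVneq g h.
    by have [gk|_] := eqVneq g k; rewrite ?ler0n // -gk gb eqxx.
  have [gk|_] := eqVneq g k.
    by rewrite -gk [h == g]eq_sym (negbTE gh) gb eqxx addr0.
  by have [hk|_] := eqVneq h k; rewrite add0r ?ler0n // -hk hb eqxx.
have := lerD (ler_wpM2l (_ : 0 <= 1 - t) (k_le p)) (ler_wpM2l (_ : 0 <= t) (k_le q)).
rewrite /pair_weight !edge_pointE; case: (g == h) => th.
  by apply: th; lra.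
by apply: le_trans (th _ _); lra.
Qed.

(** The bounds on the weights of the two sides add up to 1, so both weights cannot exceed 1/2. *)
Lemma open_side_disjoint r x : cayley_graph S x ->
  open_side r true x -> ~ open_side r false x.
Proof.
move=> xS [[g h] /= [g1 h1] xgh] [[g' h'] /= [g0 h0] xgh'].
suff [p [q [t [t01 xE]]]] : exists p q t, 0 <= t <= 1 /\ x = edge_point p q t.
  have := pair_weight_edge_point p q t01 g1 h1.
  have := pair_weight_edge_point p q t01 g0 h0.
  rewrite -xE; move: xgh xgh'; case: (side r p); case: (side r q) => /=; lra.
case/cayley_graphP: xS => [[p ->]|[p [s [t [_ t01 ->]]]]].
  by exists p, p, 0; rewrite edge_point0; split=> //; lra.
by exists p, (p * s)%g, t.
Qed.

Lemma open_side_vertex r g : open_side r (side r g) (vertex R g).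
Proof.
by exists (g, g) => //=; rewrite /pair_weight !eqxx /vertex eqxx /=; lra.
Qed.

(** If the edge does not cross the wall, its ends together carry weight 1 on one side. Otherwise the
    point is not the midpoint, and the nearer end weighs more than 1/2. *)
Lemma open_side_cover r x : reflection S r -> graph_minus (eq r) x ->
  exists b, open_side r b x.
Proof.
move=> rr [/cayley_graphP[[g ->]|[g [s [t [sS t01 xE]]]]] xr].
  by exists (side r g); exact: open_side_vertex.
have /negbTE gs := generator_neq g sS.
have xg : x g = 1 - t by rewrite xE edge_pointE eqxx eq_sym gs /=; lra.
have xgs : x (g * s)%g = t by rewrite xE edge_pointE eqxx gs /=; lra.
have [rE|rE] := eqVneq r (g * s * g^-1)%g; last first.
  have sgs : side r (g * s)%g = side r g by rewrite (sideMs sideS) // (negbTE rE) addbF.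
  exists (side r g), (g, (g * s)%g) => //=.
  by rewrite /pair_weight eq_sym gs xg xgs; lra.
have t2 : t <> 2^-1.
  by move=> t2; apply: (xr r rr erefl); rewrite xE; apply/wall_edge_point.
have [t_lt|t_ge] := ltP t 2^-1.
  by exists (side r g), (g, g) => //=; rewrite /pair_weight eqxx xg; lra.
exists (side r (g * s)%g), ((g * s)%g, (g * s)%g) => //=.
rewrite /pair_weight eqxx xgs lt_neqAle t_ge andbT.
by apply/eqP => /esym.
Qed.

(** Off the wall the two open sides are disjoint and cover, so each cuts [C] in a clopen subset. *)
Lemma connected_side (r g h : W) (C : set {ptws W -> R}) : reflection S r ->
  connected C -> C `<=` graph_minus (eq r) -> C (vertex R g) -> C (vertex R h) ->
  side r g = side r h.
Proof.
move=> rr connC Cr Cg Ch; pose b := side r g.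
have CE : C `&` open_side r b = C `&` ~` open_side r (~~ b).
  apply/seteqP; split=> x [Cx xb]; split=> //.
    have [xS _] := Cr _ Cx; move: xb; case: (b) => xb xnb.
      exact: open_side_disjoint xS xb xnb.
    exact: open_side_disjoint xS xnb xb.
  by have [b'] := open_side_cover rr (Cr _ Cx); case: (b) (b') xb => [] [].
have CbC : C `&` open_side r b = C.
  apply: connC.
  - by exists (vertex R g); split=> //; exact: open_side_vertex.
  - by exists (open_side r b) => //; exact: open_open_side.
  - exists (~` open_side r (~~ b)) => //; apply: open_closedC.
    exact: open_open_side.
have [_ hb] : (C `&` open_side r b) (vertex R h) by rewrite CbC.
have hh := open_side_vertex r h; have [hS _] := Cr _ Ch.
rewrite -/b; case: (b) (side r h) hb hh => [] [] // hb hh.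
  by case: (open_side_disjoint hS hb hh).
by case: (open_side_disjoint hS hh hb).
Qed.

(** * Shi walls in terms of sides *)

Lemma graph_minus_wall (r : W) : reflection S r ->
  cayley_graph S `\` wall_of S r = graph_minus (eq r) :> set {ptws W -> R}.
Proof.
move=> rr; apply/seteqP; split=> x [xS xr]; split=> //; last exact: xr.
by move=> r' _ <-.
Qed.

Lemma graph_minus_shi : cayley_graph S `\`
    \bigcup_(M in [set M | shi_wall S M]) M =
  graph_minus (fun r => shi_wall S (wall_of S r : set {ptws W -> R})).
Proof.
apply/seteqP; split=> x [xS xM]; split=> //.
  by move=> r rr rshi xr; apply: xM; exists (wall_of S r).
move=> [M /= Mshi xM']; have [[r rr ME] _] := Mshi.
by apply: (xM r rr); rewrite -ME.
Qed.

(** If [v] is beyond [r] but not beyond [n], a geodesic from 1 to [v] crosses [r] from a vertex [u]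
    not beyond [n]. The midpoint of that edge, a point of the wall of [r], is then joined to 1 off
    the wall of [n]. *)
Lemma nonsmall_of_not_shi r : reflection S r ->
  ~ shi_wall S (wall_of S r : set {ptws W -> R}) -> nonsmall S side r.
Proof.
move=> rr /not_andP[|/contrapT]; first by case; exists r.
move=> [N [n rn ->] [H1 [H2 [[x1 x1n H1E] [x2 x2n H2E] H12 rH1 H2v]]]].
rewrite !graph_minus_wall // in x1n x2n H1E H2E.
have H21 : connected_component (graph_minus (eq n)) x2 (vertex R 1%g).
  by rewrite -H2E; exact: H2v.
have mid (u s : W) : s \in S -> r = (u * s * u^-1)%g ->
    wall_of S r (edge_point u (u * s)%g (2^-1 : R)).
  by move=> sS rE; apply/wall_edge_point => //; lra.
have nr : n != r.
  apply/eqP => nr; have [s sS [u rE]] := rr.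
  have := rH1 _ (mid u s sS rE); rewrite H1E => /connected_component_sub[_].
  by move=> /(_ n rn erefl); apply; rewrite nr; exact: mid.
exists n; split=> // v rv; apply/negPn/negP => /negbTE nv.
have [l [wv vmin]] := shortest_exists invS genS 1%g v.
have [|u [s [n1 [n2 [sS rE wu usv lE]]]]] := crossing_edge sideS (x := r) _ wv.
  by rewrite (side1 sideS) rv.
have uv : walks S u v n2.+1.
  by rewrite -add1n; apply: walks_cat (walks1 _ sS) usv.
have nu : side n u = false.
  apply/negP => nu; move: nv; rewrite (geodesic_side_le invS sideS rn wu uv _ nu) //.
  by rewrite addnS -lE.
apply: H12; rewrite H1E H2E.
have c1 : connected_component (graph_minus (eq n)) x1
    (edge_point u (u * s)%g (2^-1 : R)).
  by rewrite -H1E; apply: rH1; exact: mid.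
rewrite (same_connected_component c1) (same_connected_component H21).
apply: same_connected_component; apply: connected_component_sym.
apply: (connected_component_trans (y := vertex R u)).
  by apply: graph_minus_same_side => //; rewrite (side1 sideS) nu.
rewrite -(edge_point0 R u (u * s)%g); apply: graph_minus_adj => //;
  [by rewrite -rE; exact/eqP | lra ..].
Qed.

Lemma nonsmall_not_shi r : reflection S r -> nonsmall S side r ->
  ~ shi_wall S (wall_of S r : set {ptws W -> R}).
Proof.
move=> rr [n [rn nr rn_side]] [_ []].
exists (wall_of S n); first by exists n.
(* One end of an edge crossing [r] is beyond [r], hence beyond [n]; so is the other, as the edge
   does not cross [n]. *)
have edge_side u s : s \in S -> r = (u * s * u^-1)%g -> side n u.
  move=> sS rE; have nus : side n (u * s)%g = side n u.
    by rewrite (sideMs sideS) // -rE (negbTE nr) addbF.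
  case ru : (side r u); first exact: rn_side.
  by rewrite -nus; apply: rn_side; rewrite (sideMs sideS) // ru -rE eqxx.
have [s0 s0S [u0 rE0]] := rr.
exists (connected_component (graph_minus (eq n)) (vertex R u0)).
exists (connected_component (graph_minus (eq n)) (vertex R 1%g)).
have vn g : graph_minus (eq n) (vertex R g) by exact: graph_minus_vertex.
split.
- by exists (vertex R u0); rewrite graph_minus_wall.
- by exists (vertex R 1%g); rewrite graph_minus_wall.
- move=> HE; suff : side n u0 = side n 1%g.
    by rewrite (edge_side _ _ s0S rE0) (side1 sideS).
  apply: (connected_side rn (@component_connected _ _ (vertex R u0))).
  + exact: connected_component_sub.
  + exact: connected_component_refl.
  + by rewrite HE; exact: connected_component_refl.
- move=> x [/cayley_graphP[[g ->]|[u [s [t [sS t01 ->]]]]] xr].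
    by case: (vertex_fixed rr xr).
  have [|t2 rE] := (wall_edge_point u rr sS t01).1 _.
    by split=> //; exact: cayley_edge_point.
  apply: (connected_component_trans (y := vertex R u)).
    apply: graph_minus_same_side => //.
    by rewrite (edge_side _ _ sS rE) (edge_side _ _ s0S rE0).
  rewrite -(edge_point0 R u (u * s)%g); apply: graph_minus_adj => //;
    [by rewrite -rE; exact/eqP | lra ..].
- by move=> _ ->; exact: connected_component_refl.
Qed.

End Walls.

Theorem theorem1p1 (R : realType) (W : groupType) (S : {fset W})
    (m : W -> W -> option nat) (hW : coxeter_group S m)
    (P : set W) (hP : shi_part R S P) :
  exists2 p : W, P p & forall p' : W, P p' -> weak_le S p p'.
Proof.
have [side sideS] := coxeter_side_cocycle hW.
have [_ genS [invS2 _] _] := hW.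
have invS s : s \in S -> (s * s = 1)%g by move=> /invS2; rewrite expg2.
have [Y [x Ex YE] PE] := hP.
rewrite graph_minus_shi in Ex YE.
set A := graph_minus S _ in Ex YE.
have PY g : P g = connected_component A x (vertex R g) by rewrite PE YE.
apply: (smallest_element invS genS sideS).
(* If [r] were small, its wall would be removed, and a component could not meet both sides of it. *)
- move=> g h r; rewrite !PY => gY hY rr /negP gh; apply: contrapT => ns; apply/gh/eqP.
  apply: (connected_side invS sideS rr (@component_connected _ A x)) => // y.
  move=> /connected_component_sub[yS ywall]; split=> // _ _ <-.
  apply: ywall => //; apply: contrapT => nshi; apply: ns.
  exact: nonsmall_of_not_shi nshi.
- move=> g s; rewrite !PY => gY sS ns; apply: connected_component_trans gY _.
  rewrite -(edge_point0 R g (g * s)%g) -(edge_point1 R g (g * s)%g).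
  apply: (graph_minus_adj invS sideS) => //; [|lra ..].
  by apply: (nonsmall_not_shi invS genS sideS _ ns); exact: reflection_edge.
- have [g xg] := graph_minus_near invS sideS Ex.
  by exists g; rewrite PY.
Qed.
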